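(* Let $(M,[\,,\,])$ be a Malcev algebra over $\mathbb{F}$, $V$ a vector space over $\mathbb{F}$, and $\Omega(M,V)=(\triangleleft,\triangleright,\omega,[\,,\,])$ an extending datum of $M$ through $V$. Then $M\,\natural\,V$ is a unified product (that is, $M\oplus V$ with the bracket $$[(x,u),(y,v)]=\big([x,y]+x\triangleleft v-y\triangleleft u+\omega(u,v),\ x\triangleright v-y\triangleright u+[u,v]\big)$$ is a Malcev algebra) if and only if the following conditions hold for all $x,y,z,t\in M$ and $u,v,p,q\in V$: (U1) $[[x,z],y\triangleleft q]+[x,z]\triangleleft(y\triangleright q)=[[x,y],z]\triangleleft q+[[y,z]\triangleleft q,x]-x\triangleleft([y,z]\triangleright q)+[[z\triangleleft q,x],y]-[x\triangleleft(z\triangleright q),y]+y\triangleleft(x\triangleright(z\triangleright q))-[[x\triangleleft q,y],z]+[y\triangleleft(x\triangleright q),z]-z\triangleleft(y\triangleright(x\triangleright q))$; (U2) $[[x,z],\omega(v,q)]+[x,z]\triangleleft[v,q]=[x\triangleleft v,z]\triangleleft q-(z\triangleleft(x\triangleright v))\triangleleft q-\omega(z\triangleright(x\triangleright v),q)-[(z\triangleleft v)\triangleleft q,x]-[\omega(z\triangleright v,q),x]+x\triangleleft[z\triangleright v,q]+x\triangleleft((z\triangleleft v)\triangleright q)+[z\triangleleft q,x]\triangleleft v-(x\triangleleft(z\triangleright q))\triangleleft v-\omega(x\triangleright(z\triangleright q),v)-[(x\triangleleft q)\triangleleft v,z]-[\omega(x\triangleright q,v),z]+z\triangleleft[x\triangleright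 q,v]+z\triangleleft((x\triangleleft q)\triangleright v)$; (U3) $[x\triangleleft p,y\triangleleft q]+(x\triangleleft p)\triangleleft(y\triangleright q)-(y\triangleleft q)\triangleleft(x\triangleright p)+\omega(x\triangleright p,y\triangleright q)=([x,y]\triangleleft p)\triangleleft q+\omega([x,y]\triangleright p,q)+[(y\triangleleft p)\triangleleft q,x]+[\omega(y\triangleright p,q),x]-x\triangleleft[y\triangleright p,q]-x\triangleleft((y\triangleleft p)\triangleright q)+[[\omega(p,q),x],y]-[x\triangleleft[p,q],y]+y\triangleleft(x\triangleright[p,q])-[x\triangleleft q,y]\triangleleft p+(y\triangleleft(x\triangleright q))\triangleleft p+\omega(y\triangleright(x\triangleright q),p)$; (U4) $[x\triangleleft p,\omega(v,q)]+(x\triangleleft p)\triangleleft[v,q]-\omega(v,q)\triangleleft(x\triangleright p)+\omega(x\triangleright p,[v,q])=((x\triangleleft v)\triangleleft p)\triangleleft q+\omega(x\triangleright v,p)\triangleleft q+\omega([x\triangleright v,p],q)+\omega((x\triangleleft v)\triangleright p,q)+[\omega(v,p)\triangleleft q,x]+[\omega([v,p],q),x]-x\triangleleft[[v,p],q]-x\triangleleft(\omega(v,p)\triangleright q)+[\omega(p,q),x]\triangleleft v-(x\triangleleft[p,q])\triangleleft v-\omega(x\triangleright[p,q],v)-((x\triangleleft q)\triangleleft v)\triangleleft p-\omega(x\triangleright q,v)\triangleleft p-\omega([x\triangleright q,v],p)-\omega((x\triangleleft q)\triangleright v,p)$; (U5) $[\omega(u,p),y\triangleleft q]+\omega(u,p)\triangleleft(y\triangleright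 q)-(y\triangleleft q)\triangleleft[u,p]+\omega([u,p],y\triangleright q)=-((y\triangleleft u)\triangleleft p)\triangleleft q-\omega(y\triangleright u,p)\triangleleft q-\omega([y\triangleright u,p],q)-\omega((y\triangleleft u)\triangleright p,q)+((y\triangleleft p)\triangleleft q)\triangleleft u+\omega(y\triangleright p,q)\triangleleft u+\omega([y\triangleright p,q],u)+\omega((y\triangleleft p)\triangleright q,u)+[\omega(p,q)\triangleleft u,y]+[\omega([p,q],u),y]-y\triangleleft[[p,q],u]-y\triangleleft(\omega(p,q)\triangleright u)+[\omega(q,u),y]\triangleleft p-(y\triangleleft[q,u])\triangleleft p-\omega(y\triangleright[q,u],p)$; (U6) $[\omega(u,p),\omega(v,q)]+\omega(u,p)\triangleleft[v,q]-\omega(v,q)\triangleleft[u,p]+\omega([u,p],[v,q])=(\omega(u,v)\triangleleft p)\triangleleft q+\omega([u,v],p)\triangleleft q+\omega([[u,v],p],q)+\omega(\omega(u,v)\triangleright p,q)+(\omega(v,p)\triangleleft q)\triangleleft u+\omega([v,p],q)\triangleleft u+\omega([[v,p],q],u)+\omega(\omega(v,p)\triangleright q,u)+(\omega(p,q)\triangleleft u)\triangleleft v+\omega([p,q],u)\triangleleft v+\omega([[p,q],u],v)+\omega(\omega(p,q)\triangleright u,v)+(\omega(q,u)\triangleleft v)\triangleleft p+\omega([q,u],v)\triangleleft p+\omega([[q,u],v],p)+\omega(\omega(q,u)\triangleright v,p)$; (U7) $[x,z]\triangleright[v,q]=-[z\triangleright(x\triangleright v),q]+[x\triangleleft v,z]\triangleright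 q-(z\triangleleft(x\triangleright v))\triangleright q+x\triangleright[z\triangleright v,q]+x\triangleright((z\triangleleft v)\triangleright q)-[x\triangleright(z\triangleright q),v]+[z\triangleleft q,x]\triangleright v-(x\triangleleft(z\triangleright q))\triangleright v+z\triangleright[x\triangleright q,v]+z\triangleright((x\triangleleft q)\triangleright v)$; (U8) $[y,t]\triangleright(x\triangleright p)=t\triangleright([x,y]\triangleright p)-x\triangleright(t\triangleright(y\triangleright p))+y\triangleright(x\triangleright(t\triangleright p))-[[t,x],y]\triangleright p$; (U9) $[x\triangleright p,[v,q]]+(x\triangleleft p)\triangleright[v,q]-\omega(v,q)\triangleright(x\triangleright p)=[[x\triangleright v,p],q]+[(x\triangleleft v)\triangleright p,q]+((x\triangleleft v)\triangleleft p)\triangleright q+\omega(x\triangleright v,p)\triangleright q-x\triangleright[[v,p],q]-x\triangleright(\omega(v,p)\triangleright q)-[x\triangleright[p,q],v]+[\omega(p,q),x]\triangleright v-(x\triangleleft[p,q])\triangleright v-[[x\triangleright q,v],p]-[(x\triangleleft q)\triangleright v,p]-((x\triangleleft q)\triangleleft v)\triangleright p-\omega(x\triangleright q,v)\triangleright p$; (U10) $[x\triangleright p,y\triangleright q]+(x\triangleleft p)\triangleright(y\triangleright q)-(y\triangleleft q)\triangleright(x\triangleright p)=[[x,y]\triangleright p,q]+([x,y]\triangleleft p)\triangleright q-x\triangleright[y\triangleright p,q]-x\triangleright((y\triangleleft p)\triangleright q)+y\triangleright(x\triangleright[p,q])+[y\triangleright(x\triangleright q),p]-[x\triangleleft q,y]\triangleright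 p+(y\triangleleft(x\triangleright q))\triangleright p$; (U11) $[[u,p],[v,q]]+\omega(u,p)\triangleright[v,q]-\omega(v,q)\triangleright[u,p]=[[[u,v],p],q]+[\omega(u,v)\triangleright p,q]+(\omega(u,v)\triangleleft p)\triangleright q+\omega([u,v],p)\triangleright q+[[[v,p],q],u]+[\omega(v,p)\triangleright q,u]+(\omega(v,p)\triangleleft q)\triangleright u+\omega([v,p],q)\triangleright u+[[[p,q],u],v]+[\omega(p,q)\triangleright u,v]+(\omega(p,q)\triangleleft u)\triangleright v+\omega([p,q],u)\triangleright v+[[[q,u],v],p]+[\omega(q,u)\triangleright v,p]+(\omega(q,u)\triangleleft v)\triangleright p+\omega([q,u],v)\triangleright p$.
   Context: All algebras and vector spaces are over an algebraically closed field $\mathbb{F}$ of characteristic different from $2$ and $3$. A Malcev algebra is a vector space $M$ with a bilinear operation $[\,,\,]:M\times M\to M$ such that $[x,y]=-[y,x]$ and $J(x,y,[x,z])=[J(x,y,z),x]$ for all $x,y,z\in M$, where $J(x,y,z)=[[x,y],z]+[[y,z],x]+[[z,x],y]$. An extending datum of a Malcev algebra $M$ through a vector space $V$ is a system $\Omega(M,V)=(\triangleleft,\triangleright,\omega,[\,,\,])$ consisting of two bilinear maps $\triangleright:M\times V\to V$ and $\triangleleft:M\times V\to M$ and two skew-symmetric bilinear maps $[\,,\,]:V\times V\to V$ and $\omega:V\times V\to M$. The bracket symbol $[\,,\,]$ denotes the bracket of $M$ on elements of $M$ and the given map $V\times V\to V$ on elements of $V$. $M\,\natural\,V$ denotes the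 vector space $M\oplus V$ with the bracket displayed in the claim; it is called a unified product if this bracket makes it a Malcev algebra. *)

(* Defs.v *)
From HB Require Import structures.
From mathcomp Require Import all_boot all_order all_algebra.

Set Implicit Arguments.
Unset Strict Implicit.
Unset Printing Implicit Defensive.

Import GRing.Theory.
Local Open Scope ring_scope.

Definition skew_symmetric (F : fieldType) (U W : lmodType F)
  (f : U -> U -> W) : Prop := forall x y, f x y = - f y x.

Definition jacobian (F : fieldType) (A : lmodType F) (br : A -> A -> A)
  (x y z : A) : A := br (br x y) z + br (br y z) x + br (br z x) y.

Definition malcev_identity (F : fieldType) (A : lmodType F)
  (br : A -> A -> A) : Prop :=
  forall x y z, jacobian br x y (br x z) = br (jacobian br x y z) x.

Definition is_malcev (F : fieldType) (A : lmodType F)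
  (br : A -> A -> A) : Prop :=
  [/\ bilinear_for *:%R *:%R br, skew_symmetric br & malcev_identity br].

Record extending_datum (F : fieldType) (M V : lmodType F) := ExtendingDatum {
  ed_left : {bilinear M -> V -> M};   (* x ◁ v *)
  ed_right : {bilinear M -> V -> V};  (* x ▷ v *)
  ed_omega : {bilinear V -> V -> M};
  ed_br : {bilinear V -> V -> V};
  ed_omega_skew : skew_symmetric ed_omega;
  ed_br_skew : skew_symmetric ed_br
}.

Section UnifiedProduct.

Variables (F : fieldType) (M V : lmodType F).
Variables (brM : M -> M -> M) (Om : extending_datum M V).

(* The overloaded bracket symbol is split: ⟦ , ⟧ is the bracket of M and
   ⟪ , ⟫ is the map V x V -> V of the datum. *)
Local Notation "⟦ x , y ⟧" := (brM x y) (at level 0).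
Local Notation "⟪ u , v ⟫" := (ed_br Om u v) (at level 0).
Local Notation "x ◁ v" := (ed_left Om x v) (at level 32, no associativity).
Local Notation "x ▷ v" := (ed_right Om x v) (at level 32, no associativity).
Local Notation "'ω(' u , v ')'" := (ed_omega Om u v) (at level 0).

Definition unified_bracket (a b : M * V) : M * V :=
  let: (x, u) := a in let: (y, v) := b in
  (⟦x, y⟧ + x ◁ v - y ◁ u + ω(u, v), x ▷ v - y ▷ u + ⟪u, v⟫).

Definition is_unified_product : Prop := is_malcev unified_bracket.

Definition U1 : Prop := forall (x y z : M) (q : V),
  ⟦⟦x, z⟧, y ◁ q⟧ + ⟦x, z⟧ ◁ (y ▷ q) =
    ⟦⟦x, y⟧, z⟧ ◁ q + ⟦⟦y, z⟧ ◁ q, x⟧ - x ◁ (⟦y, z⟧ ▷ q) + ⟦⟦z ◁ q, x⟧, y⟧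
    - ⟦x ◁ (z ▷ q), y⟧ + y ◁ (x ▷ (z ▷ q)) - ⟦⟦x ◁ q, y⟧, z⟧
    + ⟦y ◁ (x ▷ q), z⟧ - z ◁ (y ▷ (x ▷ q)).

Definition U2 : Prop := forall (x z : M) (v q : V),
  ⟦⟦x, z⟧, ω(v, q)⟧ + ⟦x, z⟧ ◁ ⟪v, q⟫ =
    ⟦x ◁ v, z⟧ ◁ q - (z ◁ (x ▷ v)) ◁ q - ω(z ▷ (x ▷ v), q) - ⟦(z ◁ v) ◁ q, x⟧
    - ⟦ω(z ▷ v, q), x⟧ + x ◁ ⟪z ▷ v, q⟫ + x ◁ ((z ◁ v) ▷ q) + ⟦z ◁ q, x⟧ ◁ v
    - (x ◁ (z ▷ q)) ◁ v - ω(x ▷ (z ▷ q), v) - ⟦(x ◁ q) ◁ v, z⟧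
    - ⟦ω(x ▷ q, v), z⟧ + z ◁ ⟪x ▷ q, v⟫ + z ◁ ((x ◁ q) ▷ v).

Definition U3 : Prop := forall (x y : M) (p q : V),
  ⟦x ◁ p, y ◁ q⟧ + (x ◁ p) ◁ (y ▷ q) - (y ◁ q) ◁ (x ▷ p) + ω(x ▷ p, y ▷ q) =
    (⟦x, y⟧ ◁ p) ◁ q + ω(⟦x, y⟧ ▷ p, q) + ⟦(y ◁ p) ◁ q, x⟧ + ⟦ω(y ▷ p, q), x⟧
    - x ◁ ⟪y ▷ p, q⟫ - x ◁ ((y ◁ p) ▷ q) + ⟦⟦ω(p, q), x⟧, y⟧
    - ⟦x ◁ ⟪p, q⟫, y⟧ + y ◁ (x ▷ ⟪p, q⟫) - ⟦x ◁ q, y⟧ ◁ p + (y ◁ (x ▷ q)) ◁ p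
    + ω(y ▷ (x ▷ q), p).

Definition U4 : Prop := forall (x : M) (v p q : V),
  ⟦x ◁ p, ω(v, q)⟧ + (x ◁ p) ◁ ⟪v, q⟫ - ω(v, q) ◁ (x ▷ p) + ω(x ▷ p, ⟪v, q⟫) =
    ((x ◁ v) ◁ p) ◁ q + ω(x ▷ v, p) ◁ q + ω(⟪x ▷ v, p⟫, q)
    + ω((x ◁ v) ▷ p, q) + ⟦ω(v, p) ◁ q, x⟧ + ⟦ω(⟪v, p⟫, q), x⟧
    - x ◁ ⟪⟪v, p⟫, q⟫ - x ◁ (ω(v, p) ▷ q) + ⟦ω(p, q), x⟧ ◁ v
    - (x ◁ ⟪p, q⟫) ◁ v - ω(x ▷ ⟪p, q⟫, v) - ((x ◁ q) ◁ v) ◁ p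
    - ω(x ▷ q, v) ◁ p - ω(⟪x ▷ q, v⟫, p) - ω((x ◁ q) ▷ v, p).

Definition U5 : Prop := forall (y : M) (u p q : V),
  ⟦ω(u, p), y ◁ q⟧ + ω(u, p) ◁ (y ▷ q) - (y ◁ q) ◁ ⟪u, p⟫ + ω(⟪u, p⟫, y ▷ q) =
    - ((y ◁ u) ◁ p) ◁ q - ω(y ▷ u, p) ◁ q - ω(⟪y ▷ u, p⟫, q)
    - ω((y ◁ u) ▷ p, q) + ((y ◁ p) ◁ q) ◁ u + ω(y ▷ p, q) ◁ u
    + ω(⟪y ▷ p, q⟫, u) + ω((y ◁ p) ▷ q, u) + ⟦ω(p, q) ◁ u, y⟧
    + ⟦ω(⟪p, q⟫, u), y⟧ - y ◁ ⟪⟪p, q⟫, u⟫ - y ◁ (ω(p, q) ▷ u)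
    + ⟦ω(q, u), y⟧ ◁ p - (y ◁ ⟪q, u⟫) ◁ p - ω(y ▷ ⟪q, u⟫, p).

Definition U6 : Prop := forall (u v p q : V),
  ⟦ω(u, p), ω(v, q)⟧ + ω(u, p) ◁ ⟪v, q⟫ - ω(v, q) ◁ ⟪u, p⟫
  + ω(⟪u, p⟫, ⟪v, q⟫) =
    (ω(u, v) ◁ p) ◁ q + ω(⟪u, v⟫, p) ◁ q + ω(⟪⟪u, v⟫, p⟫, q)
    + ω(ω(u, v) ▷ p, q) + (ω(v, p) ◁ q) ◁ u + ω(⟪v, p⟫, q) ◁ u
    + ω(⟪⟪v, p⟫, q⟫, u) + ω(ω(v, p) ▷ q, u) + (ω(p, q) ◁ u) ◁ v
    + ω(⟪p, q⟫, u) ◁ v + ω(⟪⟪p, q⟫, u⟫, v) + ω(ω(p, q) ▷ u, v)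
    + (ω(q, u) ◁ v) ◁ p + ω(⟪q, u⟫, v) ◁ p + ω(⟪⟪q, u⟫, v⟫, p)
    + ω(ω(q, u) ▷ v, p).

Definition U7 : Prop := forall (x z : M) (v q : V),
  ⟦x, z⟧ ▷ ⟪v, q⟫ =
    - ⟪z ▷ (x ▷ v), q⟫ + ⟦x ◁ v, z⟧ ▷ q - (z ◁ (x ▷ v)) ▷ q + x ▷ ⟪z ▷ v, q⟫
    + x ▷ ((z ◁ v) ▷ q) - ⟪x ▷ (z ▷ q), v⟫ + ⟦z ◁ q, x⟧ ▷ v
    - (x ◁ (z ▷ q)) ▷ v + z ▷ ⟪x ▷ q, v⟫ + z ▷ ((x ◁ q) ▷ v).

Definition U8 : Prop := forall (x y t : M) (p : V),
  ⟦y, t⟧ ▷ (x ▷ p) =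
    t ▷ (⟦x, y⟧ ▷ p) - x ▷ (t ▷ (y ▷ p)) + y ▷ (x ▷ (t ▷ p))
    - ⟦⟦t, x⟧, y⟧ ▷ p.

Definition U9 : Prop := forall (x : M) (v p q : V),
  ⟪x ▷ p, ⟪v, q⟫⟫ + (x ◁ p) ▷ ⟪v, q⟫ - ω(v, q) ▷ (x ▷ p) =
    ⟪⟪x ▷ v, p⟫, q⟫ + ⟪(x ◁ v) ▷ p, q⟫ + ((x ◁ v) ◁ p) ▷ q + ω(x ▷ v, p) ▷ q
    - x ▷ ⟪⟪v, p⟫, q⟫ - x ▷ (ω(v, p) ▷ q) - ⟪x ▷ ⟪p, q⟫, v⟫
    + ⟦ω(p, q), x⟧ ▷ v - (x ◁ ⟪p, q⟫) ▷ v - ⟪⟪x ▷ q, v⟫, p⟫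
    - ⟪(x ◁ q) ▷ v, p⟫ - ((x ◁ q) ◁ v) ▷ p - ω(x ▷ q, v) ▷ p.

Definition U10 : Prop := forall (x y : M) (p q : V),
  ⟪x ▷ p, y ▷ q⟫ + (x ◁ p) ▷ (y ▷ q) - (y ◁ q) ▷ (x ▷ p) =
    ⟪⟦x, y⟧ ▷ p, q⟫ + (⟦x, y⟧ ◁ p) ▷ q - x ▷ ⟪y ▷ p, q⟫ - x ▷ ((y ◁ p) ▷ q)
    + y ▷ (x ▷ ⟪p, q⟫) + ⟪y ▷ (x ▷ q), p⟫ - ⟦x ◁ q, y⟧ ▷ p
    + (y ◁ (x ▷ q)) ▷ p.

Definition U11 : Prop := forall (u v p q : V),
  ⟪⟪u, p⟫, ⟪v, q⟫⟫ + ω(u, p) ▷ ⟪v, q⟫ - ω(v, q) ▷ ⟪u, p⟫ =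
    ⟪⟪⟪u, v⟫, p⟫, q⟫ + ⟪ω(u, v) ▷ p, q⟫ + (ω(u, v) ◁ p) ▷ q
    + ω(⟪u, v⟫, p) ▷ q + ⟪⟪⟪v, p⟫, q⟫, u⟫ + ⟪ω(v, p) ▷ q, u⟫
    + (ω(v, p) ◁ q) ▷ u + ω(⟪v, p⟫, q) ▷ u + ⟪⟪⟪p, q⟫, u⟫, v⟫
    + ⟪ω(p, q) ▷ u, v⟫ + (ω(p, q) ◁ u) ▷ v + ω(⟪p, q⟫, u) ▷ v
    + ⟪⟪⟪q, u⟫, v⟫, p⟫ + ⟪ω(q, u) ▷ v, p⟫ + (ω(q, u) ◁ v) ▷ p
    + ω(⟪q, u⟫, v) ▷ p.

End UnifiedProduct.

(* Main.v *)
(* In characteristic not 2, the Malcev identity of a skew-symmetric bilinear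
   bracket is equivalent to Sagle's identity
     [[x,z],[y,t]] = [[[x,y],z],t] + [[[y,z],t],x] + [[[z,t],x],y] + [[[t,x],y],z],
   which is multilinear and invariant under cyclic shifts of (x,y,z,t).  On
   M x V it therefore has to be checked only on arguments taken in M or in V, and
   up to cyclic shift only for the patterns MMMM, MMMV, MMVV, MVMV, MVVV and VVVV.
   The first is Sagle's identity of M; the M- and V-components of the others are
   (U1, U8), (U3, U10), (U2, U7), (U4, U9) and (U6, U11), while U5 is the
   M-component of the pattern VMVV, a cyclic shift of MVVV. *)
Require Import Defs.
From HB Require Import structures.
From mathcomp Require Import all_boot all_order all_algebra.

Set Implicit Arguments.
Unset Strict Implicit.
Unset Printing Implicit Defensive.

Import GRing.Theory.
Local Open Scope ring_scope.

(** * Deciding identities of abelian groups by comparing integer coefficients *)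

Inductive zexpr : Type :=
  | ZVar of nat | ZZero | ZAdd of zexpr & zexpr | ZOpp of zexpr.

Fixpoint zeval (V : zmodType) (env : seq V) (e : zexpr) : V :=
  match e with
  | ZVar i => env`_i
  | ZZero => 0
  | ZAdd e1 e2 => zeval env e1 + zeval env e2
  | ZOpp e1 => - zeval env e1
  end.

Fixpoint zcoef (e : zexpr) (i : nat) : int :=
  match e with
  | ZVar j => (i == j)%:R
  | ZZero => 0
  | ZAdd e1 e2 => zcoef e1 i + zcoef e2 i
  | ZOpp e1 => - zcoef e1 i
  end.

Lemma zevalE (V : zmodType) (env : seq V) (e : zexpr) :
  zeval env e = \sum_(i < size env) env`_i *~ zcoef e i.
Proof.
elim: e => [j||e1 IH1 e2 IH2|e IH] /=.
- have [ltj|gej] := ltnP j (size env).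
    rewrite (bigD1 (Ordinal ltj)) //= eqxx mulr1z big1 ?addr0 // => i.
    by rewrite -val_eqE /= => /negPf->; rewrite mulr0z.
  (* An index beyond the environment reads the default 0, and every coefficient within range is then
     0 as well. *)
  rewrite nth_default // big1 // => i _.
  by rewrite (ltn_eqF (leq_trans (ltn_ord i) gej)) mulr0z.
- by rewrite big1 // => i _; rewrite mulr0z.
- by rewrite IH1 IH2 -big_split; apply: eq_bigr => i _; rewrite mulrzDr.
- by rewrite IH -sumrN; apply: eq_bigr => i _; rewrite mulrNz.
Qed.

Lemma zeval_inj (V : zmodType) (env : seq V) (e1 e2 : zexpr) :
  all (fun i => zcoef e1 i == zcoef e2 i) (iota 0 (size env)) ->
  zeval env e1 = zeval env e2.
Proof.
move=> /allP e12; rewrite !zevalE; apply: eq_bigr => i _.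
by rewrite (eqP (e12 i _)) // mem_iota add0n ltn_ord.
Qed.

(* Atoms are compared up to conversion because the same operation can occur
   through different structure projections. *)
Ltac zmod_index env a :=
  lazymatch env with
  | ?b :: ?env' =>
    match goal with
    | _ => let _ := match goal with _ => unify a b end in constr:(0%N)
    | _ => let n := zmod_index env' a in constr:(n.+1)
    end
  end.

Ltac zmod_atoms env e :=
  lazymatch e with
  | ?a + ?b => let env' := zmod_atoms env a in zmod_atoms env' b
  | - ?a => zmod_atoms env a
  | 0 => env
  | _ =>
    match goal with
    | _ => let _ := zmod_index env e in env
    | _ => constr:(e :: env)
    end
  end.

Ltac zmod_reify env e :=
  lazymatch e with
  | ?a + ?b =>
    let a' := zmod_reify env a in let b' := zmod_reify env b in
    constr:(ZAdd a' b')
  | - ?a => let a' := zmod_reify env a in constr:(ZOpp a')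
  | 0 => constr:(ZZero)
  | _ => let n := zmod_index env e in constr:(ZVar n)
  end.

(* Decides the identities that hold in every abelian group. *)
Ltac zmod :=
  lazymatch goal with
  | |- @eq ?T ?a ?b =>
    let env := zmod_atoms (@nil T) a in
    let env := zmod_atoms env b in
    let a' := zmod_reify env a in
    let b' := zmod_reify env b in
    apply: (@zeval_inj _ env a' b'); vm_compute; reflexivity
  end.

(** Reduces deriving one equation from another to the equality of their differences, which is an
    identity of abelian groups. *)
Lemma eq_from_sub (V : zmodType) (a b c d : V) :
  c = d -> a - b = c - d -> a = b.
Proof. by move=> -> /eqP; rewrite subrr subr_eq0 => /eqP. Qed.

(** * Sagle's form of the Malcev identity *)

Definition sagle (F : fieldType) (A : lmodType F) (br : A -> A -> A)
    (x y z t : A) : A :=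
  br (br x z) (br y t) - (br (br (br x y) z) t + br (br (br y z) t) x
                          + br (br (br z t) x) y + br (br (br t x) y) z).

Section Sagle.

Variables (F : fieldType) (A : lmodType F) (br : {bilinear A -> A -> A}).
Hypothesis brC : skew_symmetric br.

Lemma sagleDl (x x' y z t : A) :
  sagle br (x + x') y z t = sagle br x y z t + sagle br x' y z t.
Proof. by rewrite /sagle !(linearDl, linearDr); zmod. Qed.

(** The four nested brackets are permuted among themselves; in the product of two brackets,
    exchanging the factors and then reversing [br z x] produces two signs that cancel. *)
Lemma sagle_cycle (x y z t : A) : sagle br y z t x = sagle br x y z t.
Proof.
by rewrite /sagle [br (br y t) _]brC [br z x]brC linearNl opprK; zmod.
Qed.

Lemma sagleDr (x y y' z t : A) :
  sagle br x (y + y') z t = sagle br x y z t + sagle br x y' z t.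
Proof. by rewrite -sagle_cycle sagleDl !(sagle_cycle x). Qed.

Hypothesis char2 : 2%N \notin [pchar F].

Lemma eq_oppr0 (x : A) : x = - x -> x = 0.
Proof.
move=> /eqP; rewrite -subr_eq0 opprK -mulr2n -scaler_nat scaler_eq0.
by move: char2; rewrite inE /= => /negbTE-> /eqP.
Qed.

Lemma brxx (x : A) : br x x = 0.
Proof. by apply: eq_oppr0; rewrite -brC. Qed.

(** With equal outer arguments the summand containing [br x x] drops out. On the right,
    [br (br y (br x z)) x] cancels against [br (br (br z x) y) x] by skew-symmetry. *)
Lemma sagle_diag (x y z : A) :
  sagle br x y z x = jacobian br x y (br x z) - br (jacobian br x y z) x.
Proof.
rewrite /sagle /jacobian brxx !linearDl !linear0l [br (br x z) (br y x)]brC.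
rewrite [br y x]brC [br z x]brC [br y (br x z)]brC !linearNl.
by zmod.
Qed.

(* Polarizing the Malcev identity makes [sagle br] change sign when its outer
   arguments are exchanged, hence, by cyclic invariance, under every exchange of
   adjacent arguments; a 4-cycle is odd, so [sagle br] is its own opposite. *)
Lemma malcev_identityP :
  malcev_identity br <-> forall x y z t, sagle br x y z t = 0.
Proof.
split=> [malc x y z t|sagle0 x y z]; last first.
  by apply/eqP; rewrite -subr_eq0 -sagle_diag sagle0.
have diag0 a b c : sagle br a b c a = 0 by rewrite sagle_diag malc subrr.
have diag0' a b c : sagle br a a b c = 0 by rewrite -sagle_cycle diag0.
have swap a b c d : sagle br a b c d = - sagle br b a c d.
  have := diag0' (a + b) c d.
  rewrite sagleDl !sagleDr !diag0' add0r addr0 => /eqP.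
  by rewrite addr_eq0 => /eqP.
apply: eq_oppr0.
rewrite {1}swap -[sagle br y x z t]sagle_cycle swap.
by rewrite -[sagle br z x t y]sagle_cycle swap -sagle_cycle !opprK.
Qed.

End Sagle.

(** * The unified bracket and its values on arguments from M and from V *)

Section UnifiedProduct.

Variables (F : fieldType) (M V : lmodType F).
Variables (brM : {bilinear M -> M -> M}) (Om : extending_datum M V).

Local Notation br := (unified_bracket brM Om).
Local Notation S := (sagle br).

Lemma addr_pair (x y : M) (u v : V) : (x, u) + (y, v) = (x + y, u + v).
Proof. by []. Qed.

Lemma oppr_pair (x : M) (u : V) : - (x, u) = (- x, - u).
Proof. by []. Qed.

Lemma unified_bracket_bilinear : bilinear_for *:%R *:%R br.
Proof.
split=> [[y v]|[x u]] a [x1 u1] [x2 u2]; congr (_, _) => /=;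
  rewrite !(linearPl, linearPr) ?scalerDr ?scalerN /=; zmod.
Qed.

(** Makes the results on [sagle], stated for bilinear maps, apply to the unified bracket. *)
HB.instance Definition _ := bilinear_isBilinear.Build F (M * V)%type (M * V)%type
  (M * V)%type *:%R *:%R (unified_bracket brM Om) unified_bracket_bilinear.

Lemma unified_bracket_skew : skew_symmetric brM -> skew_symmetric br.
Proof.
move=> brMC [x u] [y v]; congr (_, _) => /=.
  by rewrite (brMC x) (ed_omega_skew Om u); zmod.
by rewrite (ed_br_skew Om u); zmod.
Qed.

Lemma bracketMM (x y : M) : br (x, 0) (y, 0) = (brM x y, 0).
Proof. by rewrite /= !(linear0l, linear0r, oppr0, addr0, add0r). Qed.

Lemma bracketMV (x : M) (v : V) :
  br (x, 0) (0, v) = (ed_left Om x v, ed_right Om x v).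
Proof. by rewrite /= !(linear0l, linear0r, oppr0, addr0, add0r). Qed.

Lemma bracketVM (u : V) (y : M) :
  br (0, u) (y, 0) = (- ed_left Om y u, - ed_right Om y u).
Proof. by rewrite /= !(linear0l, linear0r, oppr0, addr0, add0r). Qed.

Lemma bracketVV (u v : V) : br (0, u) (0, v) = (ed_omega Om u v, ed_br Om u v).
Proof. by rewrite /= !(linear0l, linear0r, oppr0, addr0, add0r). Qed.

Lemma bracketPM (x y : M) (u : V) :
  br (x, u) (y, 0) = (brM x y - ed_left Om y u, - ed_right Om y u).
Proof. by rewrite /= !(linear0l, linear0r, oppr0, addr0, add0r). Qed.

Lemma bracketPV (x : M) (u v : V) :
  br (x, u) (0, v) =
  (ed_left Om x v + ed_omega Om u v, ed_right Om x v + ed_br Om u v).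
Proof. by rewrite /= !(linear0l, linear0r, oppr0, addr0, add0r). Qed.

Lemma bracketPP (x y : M) (u v : V) :
  br (x, u) (y, v) =
  (brM x y + ed_left Om x v - ed_left Om y u + ed_omega Om u v,
   ed_right Om x v - ed_right Om y u + ed_br Om u v).
Proof. by []. Qed.

Ltac expand_bracket := rewrite /sagle; repeat match goal with
  | |- context [unified_bracket _ _ (?x, 0) (?y, 0)] => rewrite (bracketMM x y)
  | |- context [unified_bracket _ _ (?x, 0) (0, ?v)] => rewrite (bracketMV x v)
  | |- context [unified_bracket _ _ (0, ?u) (?y, 0)] => rewrite (bracketVM u y)
  | |- context [unified_bracket _ _ (0, ?u) (0, ?v)] => rewrite (bracketVV u v)
  | |- context [unified_bracket _ _ (?x, ?u) (?y, 0)] =>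
    rewrite (bracketPM x y u)
  | |- context [unified_bracket _ _ (?x, ?u) (0, ?v)] =>
    rewrite (bracketPV x u v)
  | |- context [unified_bracket _ _ (?x, ?u) (?y, ?v)] =>
    rewrite (bracketPP x y u v)
  | |- context [(?x, ?u) + (?y, ?v)] => rewrite (addr_pair x y u v)
  | |- context [- (?x, ?u)] => rewrite (oppr_pair x u)
  end.

Lemma pair_eq0 (x : M) (u : V) : (x, u) = 0 <-> x = 0 /\ u = 0.
Proof. by split=> [[]|[-> ->]]. Qed.

Ltac push_linear := repeat match goal with
  | |- context [@Bilinear.sort _ _ _ _ _ _ ?f (?a + ?b) ?c] =>
    rewrite (linearDl f c a b)
  | |- context [@Bilinear.sort _ _ _ _ _ _ ?f (- ?a) ?c] =>
    rewrite (linearNl f c a)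
  | |- context [@Bilinear.sort _ _ _ _ _ _ ?f 0 ?c] =>
    rewrite (linear0l f c)
  | |- context [@Bilinear.sort _ _ _ _ _ _ ?f ?c (?a + ?b)] =>
    rewrite (linearDr f c a b)
  | |- context [@Bilinear.sort _ _ _ _ _ _ ?f ?c (- ?a)] =>
    rewrite (linearNr f c a)
  | |- context [@Bilinear.sort _ _ _ _ _ _ ?f ?c 0] =>
    rewrite (linear0r f c)
  end.

(** A condition may enter the component of [sagle] with either sign, so both orientations are
    tried. *)
Ltac zmod_from H := first
  [ apply: (eq_from_sub H); push_linear; zmod
  | apply: (eq_from_sub (esym H)); push_linear; zmod ].

(** * Sagle's identity on each pattern of arguments *)

Lemma sagle_MMMV : skew_symmetric brM ->
  (forall x y z q, S (x, 0) (y, 0) (z, 0) (0, q) = 0) <->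
  U1 brM Om /\ U8 brM Om.
Proof.
move=> brMC; split=> [S0|[u1 u8] x y z q]; last first.
  expand_bracket; apply/pair_eq0; split.
    by zmod_from (u1 x y z q).
  (* The variables [t], [x], [y] of [U8] stand in the first, second and third places of [sagle],
     whose double product contains the reverse of the bracket in [U8]. *)
  by rewrite [brM x z]brMC; zmod_from (u8 y z x q).
split=> [x y z q|x y t p].
  have := S0 x y z q; expand_bracket => /pair_eq0[H _].
  by zmod_from H.
have := S0 t x y p; expand_bracket => /pair_eq0[_ H].
by rewrite [brM y t]brMC; zmod_from H.
Qed.

Lemma sagle_MMVV :
  (forall x y p q, S (x, 0) (y, 0) (0, p) (0, q) = 0) <-> U3 brM Om /\ U10 brM Om.
Proof.
split=> [S0|[u1 u2] x y p q]; last first.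
  expand_bracket; apply/pair_eq0; split.
    by zmod_from (u1 x y p q).
  by zmod_from (u2 x y p q).
split=> [x y p q|x y p q].
  have := S0 x y p q; expand_bracket => /pair_eq0[H _].
  by zmod_from H.
have := S0 x y p q; expand_bracket => /pair_eq0[_ H].
by zmod_from H.
Qed.

Lemma sagle_MVMV :
  (forall x v z q, S (x, 0) (0, v) (z, 0) (0, q) = 0) <-> U2 brM Om /\ U7 brM Om.
Proof.
split=> [S0|[u1 u2] x v z q]; last first.
  expand_bracket; apply/pair_eq0; split.
    by zmod_from (u1 x z v q).
  by zmod_from (u2 x z v q).
split=> [x z v q|x z v q].
  have := S0 x v z q; expand_bracket => /pair_eq0[H _].
  by zmod_from H.
have := S0 x v z q; expand_bracket => /pair_eq0[_ H].
by zmod_from H.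
Qed.

Lemma sagle_MVVV :
  (forall x v p q, S (x, 0) (0, v) (0, p) (0, q) = 0) <-> U4 brM Om /\ U9 brM Om.
Proof.
split=> [S0|[u1 u2] x v p q]; last first.
  expand_bracket; apply/pair_eq0; split.
    by zmod_from (u1 x v p q).
  by zmod_from (u2 x v p q).
split=> [x v p q|x v p q].
  have := S0 x v p q; expand_bracket => /pair_eq0[H _].
  by zmod_from H.
have := S0 x v p q; expand_bracket => /pair_eq0[_ H].
by zmod_from H.
Qed.

Lemma sagle_VVVV :
  (forall u v p q, S (0, u) (0, v) (0, p) (0, q) = 0) <-> U6 brM Om /\ U11 Om.
Proof.
split=> [S0|[u1 u2] u v p q]; last first.
  expand_bracket; apply/pair_eq0; split.
    by zmod_from (u1 u v p q).
  by zmod_from (u2 u v p q).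
split=> [u v p q|u v p q].
  have := S0 u v p q; expand_bracket => /pair_eq0[H _].
  by zmod_from H.
have := S0 u v p q; expand_bracket => /pair_eq0[_ H].
by zmod_from H.
Qed.

Lemma sagle_VMVV :
  (forall u y p q, S (0, u) (y, 0) (0, p) (0, q) = 0) -> U5 brM Om.
Proof.
move=> S0 y u p q; have := S0 u y p q; expand_bracket => /pair_eq0[H _].
by zmod_from H.
Qed.

Lemma sagle_MMMM (x y z t : M) :
  S (x, 0) (y, 0) (z, 0) (t, 0) = (sagle brM x y z t, 0).
Proof. by expand_bracket; rewrite !(addr0, oppr0). Qed.

(** Additivity splits every argument into its M- and V-parts, giving sixteen patterns; each is a
    cyclic shift of one of the six known to vanish. *)
Lemma sagle_eq0 : skew_symmetric brM ->
  (forall x y z t, sagle brM x y z t = 0) ->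
  (forall x y z q, S (x, 0) (y, 0) (z, 0) (0, q) = 0) ->
  (forall x y p q, S (x, 0) (y, 0) (0, p) (0, q) = 0) ->
  (forall x v z q, S (x, 0) (0, v) (z, 0) (0, q) = 0) ->
  (forall x v p q, S (x, 0) (0, v) (0, p) (0, q) = 0) ->
  (forall u v p q, S (0, u) (0, v) (0, p) (0, q) = 0) ->
  forall a b c d, S a b c d = 0.
Proof.
move=> brMC brM0 S1 S2 S2' S3 S4.
have S0 x y z t : S (x, 0) (y, 0) (z, 0) (t, 0) = 0.
  by rewrite sagle_MMMM brM0.
have cycle := sagle_cycle (unified_bracket_skew brMC).
have split_first b c d : (forall x, S (x, 0) b c d = 0) ->
    (forall u, S (0, u) b c d = 0) -> forall a, S a b c d = 0.
  move=> SM SV [x u].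
  have -> : (x, u) = (x, 0) + (0, u) by rewrite addr_pair addr0 add0r.
  by rewrite sagleDl SM SV addr0.
(* A cyclic shift after each splitting brings the next argument to the front; at most three further
   shifts then reach a known pattern. *)
move=> a b c d; move: a; apply/split_first => [x|x]; rewrite -cycle;
  move: b; apply/split_first => [y|y]; rewrite -cycle;
  move: c; apply/split_first => [z|z]; rewrite -cycle;
  move: d; apply/split_first => [t|t];
  do 4?[by rewrite ?(S0, S1, S2, S2', S3, S4) | rewrite -cycle].
Qed.

End UnifiedProduct.

(** Passes from the bilinearity predicate inside [is_malcev] to a bundled bilinear map, as the
    preceding results require. *)
Lemma bilinear_forP (F : fieldType) (U U' W : lmodType F) (f : U -> U' -> W) :
  bilinear_for *:%R *:%R f -> exists g : {bilinear U -> U' -> W}, f = g.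
Proof.
move=> fbil; pose b := bilinear_isBilinear.Build F U U' W *:%R *:%R f fbil.
by exists (HB.pack_for {bilinear U -> U' -> W} f b).
Qed.

Theorem theorem2p2 (F : closedFieldType)
  (F_char2 : 2%N \notin [pchar F]) (F_char3 : 3%N \notin [pchar F])
  (M V : lmodType F) (brM : M -> M -> M) (brM_malcev : is_malcev brM)
  (Om : extending_datum M V) :
  is_unified_product brM Om <->
  (U1 brM Om /\ U2 brM Om /\ U3 brM Om /\ U4 brM Om /\ U5 brM Om /\
   U6 brM Om /\ U7 brM Om /\ U8 brM Om /\ U9 brM Om /\ U10 brM Om /\
   U11 Om).
Proof.
(* The Malcev identity of M becomes Sagle's identity [B0], which settles the pattern MMMM. *)
case: brM_malcev => /bilinear_forP[B ->] BC /(malcev_identityP BC F_char2) B0.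
have brC := unified_bracket_skew Om BC.
have malcevP := malcev_identityP brC F_char2.
split=> [[_ _ /malcevP S0]|].
  have [u1 u8] := (sagle_MMMV Om BC).1 (fun _ _ _ _ => S0 _ _ _ _).
  have [u3 u10] := (sagle_MMVV B Om).1 (fun _ _ _ _ => S0 _ _ _ _).
  have [u2 u7] := (sagle_MVMV B Om).1 (fun _ _ _ _ => S0 _ _ _ _).
  have [u4 u9] := (sagle_MVVV B Om).1 (fun _ _ _ _ => S0 _ _ _ _).
  have [u6 u11] := (sagle_VVVV B Om).1 (fun _ _ _ _ => S0 _ _ _ _).
  have u5 : U5 B Om by apply: sagle_VMVV => *; apply: S0.
  by do !split.
move=> [u1 [u2 [u3 [u4 [_ [u6 [u7 [u8 [u9 [u10 u11]]]]]]]]]].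
split; [exact: unified_bracket_bilinear | exact: brC | apply/malcevP].
apply: sagle_eq0 => //.
- by apply/sagle_MMMV.
- by apply/sagle_MMVV.
- by apply/sagle_MVMV.
- by apply/sagle_MVVV.
- by apply/sagle_VVVV.
Qed.
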